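(* Let $R$ be a commutative Noetherian ring and let $N$ be a non-zero finitely generated $R$-module. Then the following conditions are equivalent: (i) For every $N$-proper ideal $\mathfrak{b}$ of $R$, the $\mathfrak{b}$-symbolic topology on $N$ is linearly equivalent to the $\mathfrak{b}$-adic topology on $N$. (ii) $\dim N\leq 1$, and for every $\mathfrak{p}\in\operatorname{Supp}(N)$ the set $\operatorname{Ass}_{R_{\mathfrak{p}}}N_{\mathfrak{p}}$ consists of a single prime ideal.
   Context: An ideal $\mathfrak{b}$ of $R$ is $N$-proper if $N/\mathfrak{b}N\neq 0$. For an ideal $\mathfrak{b}$ and an integer $n\ge 0$, the $n$th symbolic power of $\mathfrak{b}$ with respect to $N$, denoted $(\mathfrak{b}N)^{(n)}$, is the intersection of those primary components of $\mathfrak{b}^nN$ (in a minimal primary decomposition of the submodule $\mathfrak{b}^nN$ of $N$) which correspond to the minimal elements of $\operatorname{Ass}_R N/\mathfrak{b}N$. The $\mathfrak{b}$-adic topology on $N$ is the topology defined by the filtration $\{\mathfrak{b}^nN\}_{n\ge0}$ and the $\mathfrak{b}$-symbolic topology is the one defined by $\{(\mathfrak{b}N)^{(n)}\}_{n\ge 0}$. These two topologies are linearly equivalent if there is an integer $k\ge 0$ such that $(\mathfrak{b}N)^{(n+k)}\subseteq\mathfrak{b}^nN$ for all integers $n\ge 0$. *)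

(* Defs.v *)
From mathcomp Require Import all_boot all_order all_algebra.
Set Implicit Arguments. Unset Strict Implicit. Unset Printing Implicit Defensive.
Import GRing.Theory.
Local Open Scope ring_scope.

Section CommAlg.
Variable R : comNzRingType.

Definition is_ideal (I : R -> Prop) : Prop :=
  [/\ I 0, (forall a b, I a -> I b -> I (a + b)) & (forall r a, I a -> I (r * a))].

Definition is_prime_ideal (p : R -> Prop) : Prop :=
  [/\ is_ideal p, ~ p 1 & forall a b, p (a * b) -> p a \/ p b].

Definition noetherian : Prop :=
  forall c : nat -> R -> Prop, (forall i, is_ideal (c i)) ->
    (forall i r, c i r -> c i.+1 r) ->
    exists n, forall m, (n <= m)%N -> forall r, c m r -> c n r.

Variable N : lmodType R.

Definition fin_gen : Prop :=
  exists (n : nat) (g : 'I_n -> N), forall x : N,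
    exists c : 'I_n -> R, x = \sum_(i < n) c i *: g i.

Definition is_submod (L : N -> Prop) : Prop :=
  [/\ L 0, (forall x y, L x -> L y -> L (x + y)) & (forall r x, L x -> L (r *: x))].

Definition bpowN (b : R -> Prop) (n : nat) (x : N) : Prop :=
  forall L : N -> Prop, is_submod L ->
    (forall (f : 'I_n -> R) (y : N), (forall i, b (f i)) -> L ((\prod_(i < n) f i) *: y)) ->
    L x.

Definition N_proper (b : R -> Prop) : Prop := exists x : N, ~ bpowN b 1 x.

Definition Ass_quot (L : N -> Prop) (p : R -> Prop) : Prop :=
  is_prime_ideal p /\ exists x : N, forall r, p r <-> L (r *: x).

Definition min_Ass_quot (L : N -> Prop) (p : R -> Prop) : Prop :=
  Ass_quot L p /\ forall q, Ass_quot L q -> (forall r, q r -> p r) -> forall r, p r -> q r.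

Definition is_primary (Q : N -> Prop) : Prop :=
  [/\ is_submod Q, (exists x, ~ Q x) &
      forall r x, Q (r *: x) -> ~ Q x -> exists n, forall y, Q (r ^+ n *: y)].

Definition prim_rad (Q : N -> Prop) (r : R) : Prop := exists n, forall y, Q (r ^+ n *: y).

Definition min_prim_decomp (L : N -> Prop) (t : nat) (Q : nat -> N -> Prop) : Prop :=
  [/\ (forall i, (i < t)%N -> is_primary (Q i)),
      (forall x, L x <-> forall i, (i < t)%N -> Q i x),
      (forall i j, (i < t)%N -> (j < t)%N -> i <> j ->
          ~ (forall r, prim_rad (Q i) r <-> prim_rad (Q j) r)) &
      (forall j, (j < t)%N ->
          ~ (forall x, (forall i, (i < t)%N -> i <> j -> Q i x) -> Q j x))].

(* intersection of the primary components of a decomposition (t,Q) of b^n N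
   whose primes are minimal elements of Ass_R (N / bN) *)
Definition symb_part (b : R -> Prop) (t : nat) (Q : nat -> N -> Prop) (x : N) : Prop :=
  forall i, (i < t)%N -> min_Ass_quot (bpowN b 1) (prim_rad (Q i)) -> Q i x.

(* (bN)^(n+k) ⊆ b^n N for all n (for every minimal primary decomposition
   of b^(n+k) N used to compute the symbolic power) *)
Definition lin_equiv_topologies (b : R -> Prop) : Prop :=
  exists k : nat, forall n : nat, forall t Q, min_prim_decomp (bpowN b (n + k)) t Q ->
    forall x, symb_part b t Q x -> bpowN b n x.

(* elements of R_p: pairs (a, s) with s not in p;  elements of N_p: (x, t), t not in p *)
Definition loc_eq (p : R -> Prop) (f g : R * R) : Prop :=
  exists u, ~ p u /\ u * (f.1 * g.2 - g.1 * f.2) = 0.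

Definition locN_eq (p : R -> Prop) (f g : N * R) : Prop :=
  exists u, ~ p u /\ u *: (g.2 *: f.1 - f.2 *: g.1) = 0.

Definition loc_ideal (p : R -> Prop) (I : R * R -> Prop) : Prop :=
  [/\ (forall f g, ~ p f.2 -> ~ p g.2 -> loc_eq p f g -> I f -> I g),
      I (0, 1),
      (forall a s b t, ~ p s -> ~ p t -> I (a, s) -> I (b, t) -> I (a * t + b * s, s * t)) &
      (forall a s b t, ~ p s -> ~ p t -> I (b, t) -> I (a * b, s * t))].

Definition loc_prime (p : R -> Prop) (I : R * R -> Prop) : Prop :=
  [/\ loc_ideal p I, ~ I (1, 1) &
      forall a s b t, ~ p s -> ~ p t -> I (a * b, s * t) -> I (a, s) \/ I (b, t)].

Definition loc_ann (p : R -> Prop) (x : N) (t : R) (f : R * R) : Prop :=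
  locN_eq p (f.1 *: x, f.2 * t) (0, 1).

Definition loc_Ass (p : R -> Prop) (P : R * R -> Prop) : Prop :=
  loc_prime p P /\ exists x t, ~ p t /\
    forall a s, ~ p s -> (P (a, s) <-> loc_ann p x t (a, s)).

Definition loc_Ass_single (p : R -> Prop) : Prop :=
  exists P, loc_Ass p P /\
    forall Q, loc_Ass p Q -> forall a s, ~ p s -> (Q (a, s) <-> P (a, s)).

Definition in_Supp (p : R -> Prop) : Prop :=
  is_prime_ideal p /\ exists (x : N) t, ~ p t /\ ~ locN_eq p (x, t) (0, 1).

Definition mod_dim_le (d : nat) : Prop :=
  forall c : nat -> R -> Prop,
    (forall i, (i <= d.+1)%N -> in_Supp (c i)) ->
    (forall i, (i < d.+1)%N ->
       (forall r, c i r -> c i.+1 r) /\ exists r, c i.+1 r /\ ~ c i r) ->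
    False.

End CommAlg.

(* Main.v *)
Require Import Defs.
From mathcomp Require Import all_boot all_order all_algebra.
From mathcomp Require Import boolp.

Set Implicit Arguments. Unset Strict Implicit. Unset Printing Implicit Defensive.
Import GRing.Theory.
Local Open Scope ring_scope.

(** Suppose the topologies agree linearly and let p' be properly contained in q,
both in Supp N.  For x in p' the ideal b = xq satisfies x^m N <= (bN)^(m), because
no minimal prime of N/bN contains q, so x^(n+k) N <= x^n q^n N for all n; by
Krull's intersection theorem x is nilpotent on N_q, that is, p' lies in every
prime of Supp N below q.  Hence dim N <= 1 and there is at most one such p'.
The ideal b = 0 shows moreover that N has no embedded associated prime.

Conversely, let q be an embedded prime of b^n N.  It lies strictly over some p in
Supp N containing b, and dim N <= 1 makes p minimal, hence the only associated
prime of N_q, so that b is nilpotent on N_q.  Once Ann(b^n N) has become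
stationary this gives b^n N_q = 0, and q is not associated to N/b^n N.  Thus
(bN)^(n) = b^n N for all large n. *)

(** * The ascending chain condition *)

Definition acc_on (A : Type) (F : (A -> Prop) -> Prop) : Prop :=
  forall c : nat -> A -> Prop, (forall i, F (c i)) ->
    (forall i r, c i r -> c i.+1 r) ->
    exists n, forall m, (n <= m)%N -> forall r, c m r -> c n r.

(** Without a maximal [V i], choice would build a strictly ascending chain. The index may be a ring
    element or a submodule; for ideals [acc_on] unfolds to [noetherian]. *)
Lemma acc_on_maximal (A I : Type) (F : (A -> Prop) -> Prop) (D : I -> Prop)
    (V : I -> A -> Prop) (i0 : I) :
  acc_on F -> (forall i, D i -> F (V i)) -> D i0 ->
  exists i, D i /\ forall j, D j -> (forall r, V i r -> V j r) ->
    forall r, V j r -> V i r.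
Proof.
move=> accF DF Di0; apply: contrapT => nomax.
have step (i : {i | D i}) : exists j : {i | D i},
    (forall r, V (sval i) r -> V (sval j) r) /\
    exists r, V (sval j) r /\ ~ V (sval i) r.
  case: i => i Di /=; apply: contrapT => nj; apply: nomax; exists i; split=> //.
  move=> j Dj ij r Vjr; apply: contrapT => nVir; apply: nj.
  by exists (exist _ j Dj); split=> //; exists r.
have [f fP] := choice step.
pose s n := iter n f (exist _ i0 Di0).
have [|i r|n nP] := accF (fun n => V (sval (s n))).
- by move=> n; apply: DF; apply: svalP.
- by have [+ _] := fP (s i); apply.
- have [_ [r [Vr]]] := fP (s n); apply.
  exact: (nP n.+1).
Qed.

(** * Submodules, saturations, colons, support and primary submodules *)

Section Submodules.
Variables (R : comNzRingType) (N : lmodType R).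
Implicit Types (L T Q : N -> Prop) (p q b : R -> Prop) (r u : R) (x y z : N).

Lemma submodB L x y : is_submod L -> L x -> L y -> L (x - y).
Proof. by case=> _ LD LZ Lx Ly; rewrite -scaleN1r; apply: LD => //; apply: LZ. Qed.

Lemma submod_sum L (I : finType) (F : I -> N) :
  is_submod L -> (forall i, L (F i)) -> L (\sum_i F i).
Proof. by case=> L0 LD _ LF; apply: big_ind. Qed.

Lemma submod0 : is_submod (fun x : N => x = 0).
Proof.
by split=> // [x y -> ->|r x ->]; rewrite ?addr0 ?scaler0.
Qed.

Lemma submod_pow_le L r m n x :
  is_submod L -> (m <= n)%N -> L (r ^+ m *: x) -> L (r ^+ n *: x).
Proof.
by case=> _ _ LZ /subnK <- Lm; rewrite exprD -scalerA; apply: LZ.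
Qed.

Lemma submod_preim L r : is_submod L -> is_submod (fun x => L (r *: x)).
Proof.
case=> L0 LD LZ; split=> [|x y Lx Ly|s x Lx]; rewrite ?scaler0 ?scalerDr //.
  exact: LD.
by rewrite scalerA mulrC -scalerA; apply: LZ.
Qed.

Lemma submod_addscale L r :
  is_submod L -> is_submod (fun x => exists y w, L y /\ x = y + r *: w).
Proof.
case=> L0 LD LZ; split.
- by exists 0, 0; rewrite scaler0 addr0.
- move=> _ _ [y [w [Ly ->]]] [y' [w' [Ly' ->]]].
  exists (y + y'), (w + w'); split; first exact: LD.
  by rewrite scalerDr addrACA.
- move=> s _ [y [w [Ly ->]]]; exists (s *: y), (s *: w); split; first exact: LZ.
  by rewrite scalerDr !scalerA mulrC.
Qed.

Lemma colon_ideal L x : is_submod L -> is_ideal (fun r => L (r *: x)).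
Proof.
case=> L0 LD LZ; split=> [|a c La Lc|s a La]; rewrite ?scale0r ?scalerDl //.
  exact: LD.
by rewrite -scalerA; apply: LZ.
Qed.

Lemma prime_mulNN p a c : is_prime_ideal p -> ~ p a -> ~ p c -> ~ p (a * c).
Proof. by case=> _ _ pM pa pc /pM[]. Qed.

Lemma prime_exp p r n : is_prime_ideal p -> p (r ^+ n) -> p r.
Proof.
case=> _ p1 pM; elim: n => [|n IH]; first by rewrite expr0.
by rewrite exprS => /pM[].
Qed.

Lemma prime_expN p r n : is_prime_ideal p -> ~ p r -> ~ p (r ^+ n).
Proof. by move=> pp npr /(prime_exp pp). Qed.

Lemma bpowN_submod b n : is_submod (@bpowN R N b n).
Proof.
split=> [L [] //|x y bx bY L sL genL|r x bx L sL genL]; case: (sL) => _ LD LZ.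
  by apply: LD; [apply: bx|apply: bY].
by apply: LZ; apply: bx.
Qed.

Lemma bpowN_gen b n (f : 'I_n -> R) y :
  (forall i, b (f i)) -> bpowN b n ((\prod_(i < n) f i) *: y).
Proof. by move=> bf L _; apply. Qed.

Lemma bpowN_exp b n a y : b a -> bpowN b n (a ^+ n *: y).
Proof.
by move=> ba; rewrite -[n in a ^+ n]card_ord -prodr_const; apply: bpowN_gen.
Qed.

Lemma bpowN1_gen b a y : b a -> bpowN b 1 (a *: y).
Proof. by rewrite -{2}[a]expr1; apply: bpowN_exp. Qed.

Lemma bpowN_le b m n x : (m <= n)%N -> bpowN b n x -> bpowN b m x.
Proof.
move=> /subnKC <-; apply; first exact: bpowN_submod.
move=> f y bf; rewrite big_split_ord -scalerA; exact: bpowN_gen.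
Qed.

Lemma bpowN1_sub b L x :
  is_submod L -> (forall a y, b a -> L (a *: y)) -> bpowN b 1 x -> L x.
Proof. by move=> sL bL; apply=> // f y bf; rewrite big_ord1; apply: bL. Qed.

(** For q prime this is the kernel of N -> (N/L)_q, expressed without fractions. *)
Definition saturation q L x := exists u, ~ q u /\ L (u *: x).

Lemma saturation_submod q L :
  is_prime_ideal q -> is_submod L -> is_submod (saturation q L).
Proof.
move=> pq sL; case: (pq) (sL) => _ q1 _ [L0 LD LZ]; split.
- by exists 1; rewrite scaler0.
- move=> x y [u [qu Lu]] [v [qv Lv]]; exists (u * v); split.
    exact: prime_mulNN.
  rewrite scalerDr; apply: LD; last by rewrite -scalerA; apply: LZ.
  by rewrite mulrC -scalerA; apply: LZ.
- move=> r x [u [qu Lu]]; exists u; split=> //.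
  by rewrite scalerA mulrC -scalerA; apply: LZ.
Qed.

Lemma sub_saturation q L x : is_prime_ideal q -> L x -> saturation q L x.
Proof. by case=> _ q1 _ Lx; exists 1; rewrite scale1r. Qed.

Lemma saturationK q L u x :
  is_prime_ideal q -> ~ q u -> saturation q L (u *: x) -> saturation q L x.
Proof.
move=> pq qu [v [qv Lv]]; exists (v * u); rewrite -scalerA; split=> //.
exact: prime_mulNN.
Qed.

(** The colon (L : b^n) in N, built one factor at a time so that the ideal b^n is never formed. *)
Fixpoint colonpow b L n : N -> Prop :=
  if n is n'.+1 then fun x => forall a, b a -> colonpow b L n' (a *: x) else L.

Lemma colonpow_submod b L n : is_submod L -> is_submod (colonpow b L n).
Proof.
move=> sL; elim: n => //= n IH; case: (IH) => C0 CD CZ; split.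
- by move=> a _; rewrite scaler0.
- by move=> x y Cx Cy a ba; rewrite scalerDr; apply: (CD _ _ (Cx a ba) (Cy a ba)).
- by move=> r x Cx a ba; rewrite scalerA mulrC -scalerA; apply/CZ/Cx.
Qed.

Lemma colonpow_prod b L n (f : 'I_n -> R) x :
  (forall i, b (f i)) -> colonpow b L n x -> L ((\prod_(i < n) f i) *: x).
Proof.
elim: n f x => [|n IH] f x bf /=; first by rewrite big_ord0 scale1r.
by move=> Cx; rewrite big_ord_recl mulrC -scalerA; apply: IH => //; apply: Cx.
Qed.

Lemma bpowN_sub_colonpow b L n x :
  is_submod L -> (forall y, colonpow b L n y) -> bpowN b n x -> L x.
Proof.
move=> sL Call bx; apply: (bx L sL) => f y bf; exact: colonpow_prod (Call y).
Qed.

(** A fraction x/t vanishes in N_p exactly when some u outside p kills x, whatever t is, so t = 1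
    suffices. *)
Lemma in_SuppE p :
  in_Supp N p <->
  is_prime_ideal p /\ exists x : N, forall u, u *: x = 0 -> p u.
Proof.
rewrite /in_Supp /locN_eq /=; split=> -[pp].
  case=> x [t [_ H]]; split=> //; exists x => u ux; apply: contrapT => pu.
  by apply: H; exists u; rewrite scaler0 subr0 scale1r.
case=> x H; split=> //; exists x, 1; split; first by case: pp.
by case=> u [pu]; rewrite scaler0 subr0 scale1r => /H.
Qed.

Lemma Ass_quot_Supp L p : is_submod L -> Ass_quot L p -> in_Supp N p.
Proof.
case=> L0 _ _ [pp [x px]]; apply/in_SuppE; split=> //; exists x => u ux.
by apply/px; rewrite ux.
Qed.

Lemma prim_rad_prime Q : is_primary Q -> is_prime_ideal (prim_rad Q).
Proof.
case=> sQ [x0 Qx0] Qprim; have [Q0 QD QZ] := sQ; split.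
- split=> [|r s [n rn] [m sm]|s r [n rn]].
  + by exists 1%N => y; rewrite expr1 scale0r.
  + exists (n + m)%N => y; rewrite exprDn scaler_suml; apply: submod_sum => // i.
    rewrite -mulr_natl -scalerA; apply: (QZ).
    have [le_im|lt_mi] := leqP m i.
      by rewrite -scalerA; apply: QZ; apply: submod_pow_le le_im _.
    rewrite mulrC -scalerA; apply: QZ; apply: (submod_pow_le (m := n)) => //.
    by rewrite -addnBA ?leq_addr // ltnW.
  + by exists n => y; rewrite exprMn -scalerA; apply: QZ.
- by case=> n /(_ x0); rewrite expr1n scale1r.
- move=> r s [n rsn]; have [rs|nrs] := EM (prim_rad Q s); [by right|left].
  exists n => y; apply: contrapT => Qny; apply: nrs.
  have [|k kP] := Qprim (s ^+ n) (r ^+ n *: y) _ Qny.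
    by rewrite scalerA mulrC -exprMn.
  by exists (n * k)%N => w; rewrite exprM.
Qed.

Lemma primary_cancel Q r x :
  is_primary Q -> Q (r *: x) -> ~ prim_rad Q r -> Q x.
Proof. by case=> _ _ H Qrx nr; apply: contrapT => /(H _ _ Qrx). Qed.

Lemma primary_setI Q1 Q2 :
  is_primary Q1 -> is_primary Q2 ->
  (forall r, prim_rad Q1 r <-> prim_rad Q2 r) ->
  is_primary (fun x => Q1 x /\ Q2 x).
Proof.
move=> P1 P2 eq12; have [[s10 s1D s1Z] [x0 Qx0] _] := P1.
have [[s20 s2D s2Z] _ _] := P2; split.
- split=> // [x y [? ?] [? ?]|r x [? ?]]; split; auto.
- by exists x0; case.
- move=> r x [Q1r Q2r] Q12.
  have r1 : prim_rad Q1 r.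
    apply: contrapT => nr; apply: Q12; split; first exact: primary_cancel nr.
    by apply: (primary_cancel P2 Q2r); rewrite -eq12.
  have [m mP] := (eq12 r).1 r1; case: r1 => n nP.
  exists (n + m)%N => y; split.
    by rewrite exprD mulrC -scalerA; apply: s1Z.
  by rewrite exprD -scalerA; apply: s2Z.
Qed.

(** If q were inside P, then P' would lie in P, and minimality would give q <= P <= P' <= p. This
    lets an element of q be cancelled in each primary component that defines a symbolic power. *)
Lemma min_Ass_not_above L p q P P' :
  Ass_quot L P' -> (forall a, P' a -> p a) -> (forall a, p a -> q a) ->
  (exists a, q a /\ ~ p a) -> min_Ass_quot L P -> exists a, q a /\ ~ P a.
Proof.
move=> AP' P'p pq [s [qs ps]] [_ Pmin]; apply: contrapT => no.
have qP a : q a -> P a by move=> qa; apply: contrapT => nPa; apply: no; exists a.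
apply/ps/P'p/(Pmin _ AP') => [r /P'p /pq /qP //|]; exact: qP.
Qed.

End Submodules.

(** * Finitely generated modules over a Noetherian ring *)

Section FiniteModules.
Variables (R : comNzRingType) (N : lmodType R).
Hypotheses (HR : noetherian R) (HN : fin_gen N).
Implicit Types (L T Q : N -> Prop) (p q b : R -> Prop) (r u : R) (x y z : N).

(** The span of the first n terms of g; peeling off the last one suits induction on n. *)
Fixpoint gspan (g : nat -> N) (n : nat) x : Prop :=
  if n is n'.+1 then exists r, gspan g n' (x - r *: g n') else x = 0.

Lemma gspanB g n x y : gspan g n x -> gspan g n y -> gspan g n (x - y).
Proof.
elim: n x y => [|n IH] x y /=; first by move=> -> ->; rewrite subr0.
move=> [r rx] [s sy]; exists (r - s); have := IH _ _ rx sy.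
by rewrite scalerBl !opprD !opprK addrACA.
Qed.

Lemma gspanZ g n r x : gspan g n x -> gspan g n (r *: x).
Proof.
elim: n x => [|n IH] x /=; first by move=> ->; rewrite scaler0.
by case=> s /IH; rewrite scalerBr scalerA; exists (r * s).
Qed.

Lemma gspan_sum g n (c : nat -> R) : gspan g n (\sum_(i < n) c i *: g i).
Proof.
elim: n => [|n IH] /=; first by rewrite big_ord0.
by exists (c n); rewrite big_ord_recr /= addrK.
Qed.

Lemma noetherian_module : acc_on (@is_submod R N).
Proof.
have [n [g gP]] := HN.
move=> c sc cS.
have cM i j x : (i <= j)%N -> c i x -> c j x.
  by move=> /subnK <-; elim: (j - i)%N => // k IH /IH /cS.
(* Extend the generators to all of [nat], with default 0. *)
pose g' i := oapp g 0 (insub i).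
have spanT x : gspan g' n x.
  have [a ->] := gP x.
  have -> : \sum_(i < n) a i *: g i = \sum_(i < n) (oapp a 0 (insub (val i))) *: g' i.
    by apply: eq_bigr => i _; rewrite /g' valK.
  exact: (gspan_sum g' n (fun i => oapp a 0 (insub i))).
(* Stabilization is claimed only inside the span of k elements, so that induction on k applies. *)
suff stab k h : exists m, forall i, (m <= i)%N ->
    forall x, gspan h k x -> c i x -> c m x.
  by have [m mP] := stab n g'; exists m => i le_mi x; apply: mP.
have spanN j x : gspan h j x -> gspan h j (- x).
  by move=> /(@gspanZ _ _ (-1)); rewrite scaleN1r.
elim: k => [|k [m1 m1P]].
  by exists 0%N => i _ x /= -> _; case: (sc 0%N).
(* Leading coefficients at the last generator of elements of [c i]. *)
have [||m2 m2P] := HR (c := fun i r => exists x, c i x /\ gspan h k (x - r *: h k)).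
- move=> i; have [c0 cD cZ] := sc i; split.
  + exists 0; rewrite scale0r subr0; split=> //.
    by have := @gspan_sum h k (fun=> 0); rewrite big1 // => j _; rewrite scale0r.
  + move=> r s [x [cx rx]] [y [cy sy]]; exists (x + y); split; first exact: cD.
    by have := gspanB rx (spanN _ _ sy); rewrite opprK addrACA -opprD -scalerDl.
  + move=> s r [x [cx rx]]; exists (s *: x); split; first exact: cZ.
    by rewrite -scalerA -scalerBr; apply: gspanZ.
- by move=> i r [x [cx rx]]; exists x; split=> //; apply: cS.
exists (maxn m1 m2) => i; rewrite geq_max => /andP[le1 le2] x [r rx] cx.
(* This y has the same leading coefficient as x, so x - y falls into the shorter span, where the
   chain is stationary from m1 on. *)
have [y [cy ry]] : exists y, c m2 y /\ gspan h k (y - r *: h k).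
  by apply: (m2P i) => //; exists x.
have cmy : c (maxn m1 m2) y by apply: cM cy; apply: leq_maxr.
have cxy : c i (x - y) by apply: submodB => //; apply: cM cy.
have sxy : gspan h k (x - y).
  by have := gspanB rx ry; rewrite opprB addrA subrK.
have cmxy : c (maxn m1 m2) (x - y).
  by apply: (cM m1); [apply: leq_maxl|apply: m1P cxy].
by rewrite -[x](subrK y); case: (sc (maxn m1 m2)) => _ cD _; apply: cD.
Qed.

Lemma submod_maximal (G : (N -> Prop) -> Prop) L0 :
  (forall L, G L -> is_submod L) -> G L0 ->
  exists L, G L /\ forall L', G L' -> (forall x, L x -> L' x) ->
    forall x, L' x -> L x.
Proof. exact: (acc_on_maximal noetherian_module). Qed.

(** Among the r for which rz survives in the localization of N/L at S, a maximal (L : rz) is prime.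
    Below, S is the complement of a prime, {1}, or the set of products u a^m with u outside a
    prime. *)
Lemma Ass_quot_avoiding (S : R -> Prop) L z :
  is_submod L -> S 1 -> (forall s t, S s -> S t -> S (s * t)) ->
  (forall s, S s -> ~ L (s *: z)) ->
  exists r, is_prime_ideal (fun a => L (a *: (r *: z))) /\
            forall s, S s -> ~ L (s *: (r *: z)).
Proof.
move=> sL S1 SM zS.
pose D r := forall s, S s -> ~ L (s *: (r *: z)).
have [||r [Dr rmax]] := @acc_on_maximal _ _ _ D (fun r a => L (a *: (r *: z))) 1 HR.
- by move=> r _; apply: colon_ideal.
- by move=> s Ss; rewrite scale1r; apply: zS.
case: (sL) => _ _ LZ; exists r; split=> //; split; first exact: colon_ideal.
  exact: Dr.
move=> a c Lac; apply: contrapT => /not_orP[nLa nLc].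
have [Da|] := EM (D (a * r)).
  apply: nLc; apply: (rmax (a * r)) => // [s Ls|].
    by rewrite -scalerA scalerA mulrC -scalerA; apply: LZ.
  by rewrite -scalerA scalerA mulrC.
(* Now s a r z is in L, while s r z still survives; so (L : s r z), which contains a, equals (L : r
   z) by maximality. *)
move=> /existsNP[s /not_implyP[Ss /contrapT Lsa]]; apply: nLa.
apply: (rmax (s * r)) => [t St|t Lt|].
- by rewrite -[(s * r) *: z]scalerA scalerA; apply: Dr; apply: SM.
- by rewrite -scalerA scalerA mulrC -scalerA; apply: LZ.
by move: Lsa; rewrite -!scalerA !scalerA [s * a]mulrC.
Qed.

Lemma Ass_quot_below p L z :
  is_prime_ideal p -> is_submod L -> (forall u, L (u *: z) -> p u) ->
  exists r, Ass_quot L (fun a => L (a *: (r *: z))) /\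
            forall a, L (a *: (r *: z)) -> p a.
Proof.
move=> pp sL zp; case: (pp) => _ p1 _.
have [| |s /[swap] /zp //|r [rp rS]] := @Ass_quot_avoiding (fun s => ~ p s) L z sL.
- exact: p1.
- by move=> s t; apply: prime_mulNN.
exists r; split; first by split=> //; exists (r *: z).
by move=> a La; apply: contrapT => /rS.
Qed.

(* At the stable value W of the chain (L : b^n), an associated prime of N/W
   would contain b, so that W could still be enlarged. *)
Lemma colonpow_full b L :
  is_submod L -> (forall a x, b a -> exists n, L (a ^+ n *: x)) ->
  exists n, forall x, colonpow b L n x.
Proof.
move=> sL bL.
have cS n x : colonpow b L n x -> colonpow b L n.+1 x.
  by case: (colonpow_submod b n sL) => _ _ CZ Cx a ba; apply: CZ.
have LC n x : L x -> colonpow b L n x by elim: n => // n IH /IH /cS.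
have [|n nP] := noetherian_module (fun n => colonpow_submod b n sL); first exact: cS.
exists n => x; apply: contrapT => nCx.
have [| |s ->|r [rp r1]] := @Ass_quot_avoiding (fun s => s = 1) _ x (colonpow_submod b n sL).
- by [].
- by move=> s t -> ->; rewrite mulr1.
- by rewrite scale1r.
apply: (r1 1) => //; rewrite scale1r; apply: (nP n.+1) => // a ba.
have [m Lm] := bL a (r *: x) ba.
by apply: (prime_exp rp); apply: LC Lm.
Qed.

(* Take L maximal among the q-saturated submodules that contain T and miss y. *)
Lemma krull_separation q T y :
  is_prime_ideal q -> is_submod T -> ~ saturation q T y ->
  exists L, [/\ is_submod L, (forall x, T x -> L x), ~ L y,
    (forall u x, ~ q u -> L (u *: x) -> L x) &
    exists n, forall x, colonpow q L n x].
Proof.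
move=> pq sT Ty.
pose G L := [/\ is_submod L, (forall x, T x -> L x), ~ L y &
  (forall u x, ~ q u -> L (u *: x) -> L x)].
have [||L [GL Lmax]] := @submod_maximal G (saturation q T); first by move=> L [].
  split=> //; first exact: saturation_submod.
    by move=> x; apply: sub_saturation.
  by move=> u x; apply: saturationK.
have [sL TL Ly Lsat] := GL; have [L0 LD LZ] := sL; have [[q0 qD qM] q1 _] := pq.
(* By maximality of L, any strictly larger submodule has y in its q-saturation. *)
have big L' x : is_submod L' -> (forall v, L v -> L' v) -> L' x -> ~ L x ->
    saturation q L' y.
  move=> sL' LL' L'x nLx; apply: contrapT => nsat; apply: nLx.
  apply: (Lmax (saturation q L')); last 2 first.
  - by move=> v /LL'; apply: sub_saturation.
  - exact: sub_saturation.
  split=> //; first exact: saturation_submod.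
    by move=> v /TL /LL'; apply: sub_saturation.
  by move=> u v; apply: saturationK.
(* Otherwise u y = v + r a y with v in L and u outside q; then u - r a is outside q and sends y into
   L, which is saturated. *)
have qy a : q a -> L (a *: y).
  move=> qa; apply: contrapT => nLay.
  have sLR : is_submod (fun x => exists r v, L v /\ x = v + r *: (a *: y)).
    split.
    - by exists 0, 0; rewrite scale0r addr0.
    - move=> _ _ [r [v [Lv ->]]] [r' [v' [Lv' ->]]]; exists (r + r'), (v + v').
      by rewrite scalerDl addrACA; split=> //; apply: LD.
    - move=> s _ [r [v [Lv ->]]]; exists (s * r), (s *: v).
      by rewrite scalerDr -scalerA; split=> //; apply: LZ.
  have [|||u [qu [r [v [Lv uy]]]]] := big _ (a *: y) sLR.
  - by move=> v Lv; exists 0, v; rewrite scale0r addr0.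
  - by exists 1, 0; rewrite scale1r add0r.
  - by [].
  apply: Ly; apply: (Lsat (u - r * a)).
    by move=> qura; apply: qu; rewrite -[u](subrK (r * a)); apply: qD => //; apply: qM.
  by rewrite scalerBl uy -scalerA addrK.
exists L; split=> //; apply: colonpow_full => // a x qa.
(* Let (L : a^n) be stable. If a^n x were outside L, then u y = v + a^n w with v in L; since a y is
   in L, so is a^(n+1) w, hence a^n w, hence u y. *)
have [|n nP] := noetherian_module (fun n => submod_preim (a ^+ n) sL).
  by move=> n w; apply: submod_pow_le.
exists n; apply: contrapT => nLx.
have [|||u [qu [v [w [Lv uy]]]]] := big _ (a ^+ n *: x) (submod_addscale (a ^+ n) sL).
- by move=> v Lv; exists v, 0; rewrite scaler0 addr0.
- by exists 0, x; rewrite add0r.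
- by [].
have Law : L (a ^+ n *: w).
  apply: (nP n.+1) => //; rewrite exprS -scalerA.
  have -> : a ^+ n *: w = u *: y - v by rewrite uy addrC addKr.
  rewrite scalerBr; apply: submodB => //; last exact: LZ.
  by rewrite scalerA mulrC -scalerA; apply/LZ/qy.
by apply: Ly; apply: (Lsat u) => //; rewrite uy; apply: LD.
Qed.

(** If N_p = bN_p, the separating L of [krull_separation] for T = 0 satisfies p^n N <= L for some n;
    as b lies in p and L is saturated, n can be lowered to 0, forcing L = N. *)
Lemma nakayama_Supp p b :
  in_Supp N p -> (forall a, b a -> p a) ->
  exists z : N, forall u, bpowN b 1 (u *: z) -> p u.
Proof.
move=> /in_SuppE[pp [x xp]] bp; apply: contrapT => noz.
have Nsat z : saturation p (bpowN b 1) z.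
  apply: contrapT => nsat; apply: noz; exists z => u bu.
  by apply: contrapT => pu; apply: nsat; exists u.
have [|L [sL _ Lx Lsat [n]]] := @krull_separation p _ x pp (submod0 N).
  by case=> u [pu /xp].
have Csat m u z : ~ p u -> colonpow p L m (u *: z) -> colonpow p L m z.
  move=> pu; elim: m z => [|m IH] z /=; first exact: Lsat.
  by move=> Cz a pa; apply: IH; rewrite scalerA mulrC -scalerA; apply: Cz.
elim: n => [|n IH] Call; first exact: Lx (Call x).
apply: IH => z; have [u [pu bu]] := Nsat z; apply: (Csat _ u) => //.
apply: bpowN1_sub bu; first exact: colonpow_submod.
by move=> a y /bp pa; apply: Call.
Qed.

Lemma Ass_quot_bpowN_below p b :
  in_Supp N p -> (forall a, b a -> p a) ->
  exists P, Ass_quot (@bpowN R N b 1) P /\ forall a, P a -> p a.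
Proof.
move=> Sp bp; have [z zp] := nakayama_Supp Sp bp; case: Sp => pp _.
have [r [rA rp]] := Ass_quot_below pp (bpowN_submod N b 1) zp.
by exists (fun a => bpowN b 1 (a *: (r *: z))).
Qed.

Lemma Ass_below p :
  in_Supp N p ->
  exists P, Ass_quot (fun x : N => x = 0) P /\ forall a, P a -> p a.
Proof.
case/in_SuppE=> pp [z zp]; have [r [rA rp]] := Ass_quot_below pp (submod0 N) zp.
by exists (fun a => a *: (r *: z) = 0).
Qed.

(** Choose u outside q with maximal kernel on N: multiplying it by a further v outside q kills
    nothing new. *)
Lemma saturation0_uniform q :
  is_prime_ideal q ->
  exists u, ~ q u /\ forall x : N, saturation q (fun y => y = 0) x -> u *: x = 0.
Proof.
move=> pq; have [_ q1 _] := pq.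
have [|u [qu umax]] := acc_on_maximal (D := fun u => ~ q u)
    (V := fun u (x : N) => u *: x = 0) noetherian_module _ q1.
  by move=> u _; apply: submod_preim (submod0 N).
exists u; split=> // x [v [qv vx]]; apply: (umax (u * v)) => [|y uy|].
- exact: prime_mulNN.
- by rewrite mulrC -scalerA uy scaler0.
- by rewrite -scalerA vx scaler0.
Qed.

(** * Existence of minimal primary decompositions *)

Definition prim_decomp L (t : nat) (Q : nat -> N -> Prop) :=
  (forall i, (i < t)%N -> is_primary (Q i)) /\
  (forall x, L x <-> forall i, (i < t)%N -> Q i x).

(** A maximal counterexample L is not primary, witnessed by some r. Once (L : r^n) is stable, L is
    the intersection of (L : r^(n+1)) and L + r^(n+1) N, both strictly larger. *)
Lemma prim_decomp_exists L : is_submod L -> exists t (Q : nat -> N -> Prop), prim_decomp L t Q.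
Proof.
move=> sL; apply: contrapT => noL.
pose G L := is_submod L /\ ~ exists t (Q : nat -> N -> Prop), prim_decomp L t Q.
have [||{}L [[{}sL {}noL] Lmax]] := @submod_maximal G L; [by move=> ? []|by []|].
have bigger L' x : is_submod L' -> (forall v, L v -> L' v) -> L' x -> ~ L x ->
    exists t (Q : nat -> N -> Prop), prim_decomp L' t Q.
  move=> sL' LL' L'x nLx; apply: contrapT => noL'; apply: nLx.
  exact: (Lmax L').
apply: noL; have [L0 LD LZ] := sL.
have [[x0 Lx0]|/forallNP LT] := EM (exists x, ~ L x); last first.
  (* The whole module is the empty intersection. *)
  by exists 0%N, (fun=> L); split=> // x; split=> // _; apply: contrapT.
have [Lprim|] := EM (is_primary L).
  by exists 1%N, (fun=> L); split=> // x; split=> [|/(_ 0%N)]; last apply.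
move=> nprim; have [r [x [Lrx Lx nLr]]] : exists r x,
    [/\ L (r *: x), ~ L x & ~ exists n, forall y, L (r ^+ n *: y)].
  apply: contrapT => no; apply: nprim; split=> //; first by exists x0.
  by move=> r x Lrx Lx; apply: contrapT => nn; apply: no; exists r, x.
have [|n nP] := noetherian_module (fun n => submod_preim (r ^+ n) sL).
  by move=> n w; apply: submod_pow_le.
have [w Lw] : exists w, ~ L (r ^+ n.+1 *: w).
  by apply/existsNP => Lall; apply: nLr; exists n.+1.
(* The exponent is n.+1 because for n = 0 the colon (L : r^n) would be L itself and miss x. *)
have [|||t1 [Q1 [prim1 eq1]]] := bigger _ x (submod_preim (r ^+ n.+1) sL).
- by move=> v Lv; apply: LZ.
- by rewrite exprSr -scalerA; apply: LZ.
- exact: Lx.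
have [|||t2 [Q2 [prim2 eq2]]] := bigger _ (r ^+ n.+1 *: w) (submod_addscale (r ^+ n.+1) sL).
- by move=> v Lv; exists v, 0; rewrite scaler0 addr0.
- by exists 0, w; rewrite add0r.
- exact: Lw.
exists (t1 + t2)%N, (fun i => if (i < t1)%N then Q1 i else Q2 (i - t1)%N).
split=> [i lti|y].
  case: ltnP => [/prim1 //|le1i]; apply: prim2.
  by rewrite ltn_subLR.
split=> [Ly i lti|Qy].
  case: ltnP => [lt1|le1i].
    by apply: (eq1 y).1 => //; apply: LZ.
  apply: (eq2 y).1; last by rewrite ltn_subLR.
  by exists y, 0; rewrite scaler0 addr0.
have Lry : L (r ^+ n.+1 *: y).
  by apply/eq1 => i lti; have := Qy i (ltn_addr _ lti); rewrite lti.
have [v [z [Lv def_y]]] : exists v z, L v /\ y = v + r ^+ n.+1 *: z.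
  apply/eq2 => i lti; have := Qy (t1 + i)%N; rewrite ltn_add2l => /(_ lti).
  by rewrite ltnNge leq_addr addKn.
rewrite def_y; apply: LD => //; apply: (submod_pow_le sL (leqnSn n)).
apply: (nP (n.+1 + n.+1)%N); first by rewrite addSn leqW // leq_addr.
rewrite exprD -scalerA; have -> : r ^+ n.+1 *: z = y - v by rewrite def_y addrC addKr.
by rewrite scalerBr; apply: submodB => //; apply: LZ.
Qed.

Lemma prim_decomp_drop L t (Q : nat -> N -> Prop) j :
  (j < t.+1)%N -> (forall i, (i < t.+1)%N -> i <> j -> is_primary (Q i)) ->
  (forall x, L x <-> forall i, (i < t.+1)%N -> i <> j -> Q i x) ->
  prim_decomp L t (fun i => Q (bump j i)).
Proof.
move=> ltj primQ eqQ.
have ltb i : (i < t)%N -> (bump j i < t.+1)%N.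
  by rewrite /bump => lti; case: (j <= i)%N; rewrite ?add1n ?add0n ltnS // ltnW.
have neb i : bump j i <> j by apply/eqP; rewrite eq_sym; apply: neq_bump.
split=> [i /ltb lti|x]; first exact: primQ.
split=> [/eqQ Qx i /ltb lti|Qx]; first exact: Qx.
apply/eqQ => i lti /eqP ne; rewrite -(unbumpK (h := j) (x := i)) ?inE //; apply: Qx.
rewrite /unbump; case: (ltnP j i) => [ltji|leij].
  by case: i lti ltji {ne} => // i; rewrite subn1.
by rewrite /= subn0 -ltnS (leq_trans _ ltj) // ltnS ltn_neqAle ne.
Qed.

(** A decomposition with the fewest components is minimal: components with equal radicals could be
    merged, a redundant one dropped. *)
Lemma min_prim_decomp_exists L : is_submod L -> exists t (Q : nat -> N -> Prop), min_prim_decomp L t Q.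
Proof.
move=> /prim_decomp_exists[t0 ex0].
have ext0 : exists t, `[< exists Q : nat -> N -> Prop, prim_decomp L t Q >] by exists t0; apply/asboolP.
case: (ex_minnP ext0) => t /asboolP[Q [primQ eqQ]] tmin; exists t, Q; split=> //.
- suff H i j : (i < t)%N -> (j < t)%N -> i <> j ->
      ~ (forall r, prim_rad (Q i) r <-> prim_rad (Q j) r) by [].
  case: t primQ eqQ tmin => // t primQ eqQ tmin lti ltj neij eqr.
  pose Q' k := if k == i then (fun x => Q i x /\ Q j x) else Q k.
  suff : (t.+1 <= t)%N by rewrite ltnn.
  apply: tmin; apply/asboolP; exists (fun k => Q' (bump j k)).
  apply: prim_decomp_drop => // [k ltk _|x].
    by rewrite /Q'; case: eqP => _; [apply: primary_setI; auto|apply: primQ].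
  split=> [/eqQ Qx k ltk _|Qx]; first by rewrite /Q'; case: eqP => _; [split|]; apply: Qx.
  have [Qi Qj] : Q i x /\ Q j x by have := Qx i lti neij; rewrite /Q' eqxx.
  apply/eqQ => k ltk; have [->//|/eqP nekj] := eqVneq k j.
  by have := Qx k ltk nekj; rewrite /Q'; case: eqP => [->|].
- case: t primQ eqQ tmin => // t primQ eqQ tmin j ltj Hj.
  suff : (t.+1 <= t)%N by rewrite ltnn.
  apply: tmin; apply/asboolP; exists (fun k => Q (bump j k)).
  apply: prim_decomp_drop => // [k ltk _|x]; first exact: primQ.
  split=> [/eqQ Qx k ltk _|Qx]; first exact: Qx.
  by apply/eqQ => k ltk; have [->|/eqP nekj] := eqVneq k j; [apply: Hj|apply: Qx].
Qed.


(** * Associated primes of N_q and of N *)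

Lemma loc_Ass_of_Ass q P :
  is_prime_ideal q -> Ass_quot (fun x : N => x = 0) P ->
  (forall a, P a -> q a) -> loc_Ass N q (fun f => P f.1).
Proof.
move=> pq [pP [x xP]] Pq; have [[P0 PD PM] P1 Pm] := pP.
have [_ q1 _] := pq.
split; last first.
  exists x, 1; split=> // a s qs; rewrite /loc_ann /locN_eq /=.
  split=> [/xP ax|[u [qu]]].
    by exists 1; rewrite scaler0 subr0 !scale1r ax.
  rewrite scaler0 subr0 scale1r scalerA => /xP /Pm[/Pq //|//].
split=> //=; last by move=> a s c t _ _ /Pm.
split=> //=.
- move=> [a s] [c t] /= qs qt [u [qu /= Eu]] Pa.
  have : P (u * (c * s)).
    move: Eu; rewrite mulrBr => /eqP; rewrite subr_eq0 => /eqP <-.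
    by apply: (PM); rewrite mulrC; apply: PM.
  by case/Pm=> [/Pq //|/Pm[//|/Pq]].
- by move=> a s c t _ _ Pa Pc; apply: PD; rewrite mulrC; apply: PM.
- by move=> a s c t _ _ Pc; apply: PM.
Qed.

(** If I annihilates x/t, its contraction consists of the a with a x killed by some u outside q. A u
    with maximal Ann(u x) serves all a at once, so the contraction is Ann(u x). *)
Lemma Ass_of_loc_Ass q I :
  is_prime_ideal q -> loc_Ass N q I ->
  exists P, [/\ Ass_quot (fun x : N => x = 0) P, (forall a, P a -> q a) &
    forall a s, ~ q s -> (I (a, s) <-> P a)].
Proof.
move=> pq [[_ I1 IM] [x [t [qt IP]]]]; have [_ q1 _] := pq.
have {}IP a s : ~ q s -> I (a, s) <-> exists u, ~ q u /\ u *: (a *: x) = 0.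
  move=> /IP ->; rewrite /loc_ann /locN_eq /=.
  by split=> -[u [qu]]; rewrite ?scaler0 ?subr0 ?scale1r; exists u;
    rewrite ?scaler0 ?subr0 ?scale1r.
have [|u [qu umax]] := acc_on_maximal (D := fun u => ~ q u)
    (V := fun u a => a *: (u *: x) = 0) HR _ q1.
  by move=> u _; apply: (colon_ideal _ (submod0 N)).
have IE a s : ~ q s -> I (a, s) <-> a *: (u *: x) = 0.
  move=> qs; rewrite IP //; split=> [[v [qv av]]|au]; last first.
    by exists u; rewrite scalerA mulrC -scalerA.
  apply: (umax (v * u)) => [|r ru|]; first exact: prime_mulNN.
    by rewrite -scalerA scalerA mulrC -scalerA ru scaler0.
  by rewrite scalerA mulrC [v * u]mulrC -!scalerA av scaler0.
exists (fun a => a *: (u *: x) = 0); split=> //.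
- split; last by exists (u *: x).
  split; first exact: (colon_ideal _ (submod0 N)).
    by move/(IE _ 1 q1).
  move=> a c /(IE _ 1 q1) Iac; have := IM a 1 c 1 q1 q1.
  by rewrite mulr1 => /(_ Iac); rewrite !IE.
- move=> a au; apply: contrapT => qa; apply: I1; apply/IP => //.
  by exists (a * u); rewrite scale1r -scalerA; split=> //; apply: prime_mulNN.
Qed.

(** * Linear equivalence implies condition (ii) *)

Section LinearlyEquivalentTopologies.
Hypothesis lin_equiv : forall b, is_ideal b -> N_proper N b ->
  lin_equiv_topologies N b.

(** Applied to a chain p < p' < q it bounds the dimension; applied both ways to associated primes
    properly inside q it makes them equal. *)
Lemma Supp_sub_of_proper p' p q :
  in_Supp N p' -> in_Supp N p -> in_Supp N q ->
  (forall a, p' a -> q a) -> (exists a, q a /\ ~ p' a) ->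
  (forall a, p a -> q a) -> forall a, p' a -> p a.
Proof.
move=> Sp' Sp Sq p'q propq pq x p'x; apply: contrapT => npx.
have [qprime _] := Sq; have [[q0 qD qM] q1 _] := qprime.
have [[[_ _ p'M] p'1 _] _] := Sp'.
have /in_SuppE[pprime [z zp]] := Sp.
pose b r := exists a, q a /\ r = x * a.
have bp' a : b a -> p' a by case=> c [_ ->]; rewrite mulrC; apply: p'M.
have b_ideal : is_ideal b.
  split.
  - by exists 0; rewrite mulr0.
  - move=> _ _ [a [qa ->]] [c [qc ->]]; exists (a + c).
    by rewrite mulrDr; split=> //; apply: qD.
  - by move=> r _ [a [qa ->]]; exists (r * a); rewrite mulrCA; split=> //; apply: qM.
have [P' [AP' P'p']] := Ass_quot_bpowN_below Sp' bp'.
have b_proper : N_proper N b.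
  have [w wp'] := nakayama_Supp Sp' bp'; exists w => bw.
  by apply: p'1; apply: wp'; rewrite scale1r.
have [k kP] := lin_equiv b_ideal b_proper.
(* As b^n N = x^n q^n N, linear equivalence places x^k z in q^n N up to an element killed by x^n. *)
have powq n : exists w, bpowN q n w /\ x ^+ n *: (x ^+ k *: z - w) = 0.
  have [t [Q decQ]] := min_prim_decomp_exists (bpowN_submod N b (n + k)).
  have : bpowN b n (x ^+ (n + k) *: z).
    apply: (kP n t Q decQ) => i lti Pmin; have [primQ eqQ _ _] := decQ.
    (* Since x a is in b, a^(n+k) sends x^(n+k) z into b^(n+k) N; a power of a outside P can then be
       cancelled. *)
    have [a [qa Pa]] := min_Ass_not_above AP' P'p' p'q propq Pmin.
    apply: (primary_cancel (r := a ^+ (n + k)) (primQ i lti)); last first.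
      by apply: prime_expN Pa; apply/prim_rad_prime/primQ.
    rewrite scalerA -exprMn; apply: (eqQ _).1 lti; apply: bpowN_exp.
    by exists a; rewrite mulrC.
  suff bx (v : N) : bpowN b n v -> exists w, bpowN q n w /\ v = x ^+ n *: w.
    case/bx=> w [qw E]; exists w; split=> //.
    by rewrite scalerBr scalerA -exprD E subrr.
  have [B0 BD BZ] := bpowN_submod N q n.
  move=> /(_ (fun v => exists w, bpowN q n w /\ v = x ^+ n *: w)); apply.
    split.
    - by exists 0; rewrite scaler0.
    - move=> _ _ [v1 [q1' ->]] [v2 [q2' ->]]; exists (v1 + v2).
      by rewrite scalerDr; split=> //; apply: BD.
    - move=> r _ [v1 [q1' ->]]; exists (r *: v1).
      by rewrite !scalerA mulrC; split=> //; apply: BZ.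
  move=> f y /choice[g gP]; exists ((\prod_(i < n) g i) *: y); split.
    by apply: bpowN_gen => i; case: (gP i).
  rewrite scalerA; congr (_ *: _).
  rewrite (eq_bigr (fun i => x * g i)) => [|i _]; last by case: (gP i).
  by rewrite big_split /= prodr_const card_ord.
pose T (v : N) := exists n, x ^+ n *: v = 0.
have sT : is_submod T.
  split.
  - by exists 0%N; rewrite scaler0.
  - move=> v w [n vn] [m wm]; exists (n + m)%N.
    by rewrite scalerDr exprD -[in X in _ + X]scalerA wm mulrC -scalerA vn !scaler0 addr0.
  - by move=> r v [n vn]; exists n; rewrite scalerA mulrC -scalerA vn scaler0.
(* Only elements of p kill z, and u, x are outside p, so x^k z is not x-power torsion even after
   localizing at q. *)
have [|L [sL TL Lz _ [n nP]]] := krull_separation (y := x ^+ k *: z) qprime sT.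
  case=> u [qu [m]]; rewrite !scalerA => /zp.
  apply: prime_mulNN => //; last exact: prime_expN.
  by apply: prime_mulNN => //; [exact: prime_expN|move/pq].
have [w [qw xw]] := powq n; apply: Lz.
rewrite -[x ^+ k *: z](subrK w); case: (sL) => _ LD _; apply: LD.
  by apply: TL; exists n.
exact: bpowN_sub_colonpow nP qw.
Qed.

(* The case b = 0 says that 0 has no embedded component in N. *)
Lemma Ass_minimal p q :
  (exists x : N, x != 0) -> Ass_quot (fun x : N => x = 0) q -> in_Supp N p ->
  (forall a, p a -> q a) -> forall a, q a -> p a.
Proof.
move=> [x0 /eqP nzx0] [qprime [y yq]] Sp pq s qs; apply: contrapT => nps.
pose b (r : R) := r = 0.
have b_ideal : is_ideal b.
  by split=> // [a c -> ->|r a ->]; rewrite ?addr0 ?mulr0.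
have b1 (v : N) : bpowN b 1 v -> v = 0.
  by move=> /(bpowN1_sub (submod0 N)); apply=> a w ->; rewrite scale0r.
have bp a : b a -> p a by move=> ->; case: Sp => [[[]]].
have [P' [AP' P'p]] := Ass_quot_bpowN_below Sp bp.
have [|k kP] := lin_equiv b_ideal; first by exists x0 => /b1.
(* Take n = 1: for n = 0 the conclusion would be empty, as b^0 N = N. *)
have [t [Q decQ]] := min_prim_decomp_exists (bpowN_submod N b (1 + k)).
have [_ q1 _] := qprime; apply: q1; apply/yq; rewrite scale1r; apply: b1.
apply: (kP 1%N t Q decQ) => i lti Pmin; have [primQ _ _ _] := decQ.
have [|a [qa Pa]] := min_Ass_not_above AP' P'p pq _ Pmin; first by exists s.
apply: (primary_cancel (primQ i lti) _ Pa).
by rewrite (yq a).1 //; case: (primQ i lti) => [[]].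
Qed.

Lemma dim_le1_of_lin_equiv : mod_dim_le N 1.
Proof.
move=> c Sc cS; have [c01 [r [c1r c0r]]] := cS 0%N isT; have [c12 prop12] := cS 1%N isT.
by apply: c0r; apply: (Supp_sub_of_proper (Sc 1%N _) (Sc 0%N _) (Sc 2 _)) c1r; auto.
Qed.

Lemma loc_Ass_single_of_lin_equiv q :
  (exists x : N, x != 0) -> in_Supp N q -> loc_Ass_single N q.
Proof.
move=> nzN Sq; have [qprime _] := Sq; have [P [AP Pq]] := Ass_below Sq.
exists (fun f => P f.1); split; first exact: loc_Ass_of_Ass.
move=> I /(Ass_of_loc_Ass qprime)[P' [AP' P'q IP']] a s qs; rewrite IP' //=.
have sub P1 P2 : Ass_quot (fun x : N => x = 0) P1 -> Ass_quot (fun x : N => x = 0) P2 ->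
    (forall r, P1 r -> q r) -> (forall r, P2 r -> q r) -> forall r, P1 r -> P2 r.
  move=> A1 A2 s1 s2.
  have S1 := Ass_quot_Supp (submod0 N) A1; have S2 := Ass_quot_Supp (submod0 N) A2.
  (* Either P1 is properly inside q, or P1 = q is an associated prime, hence minimal in the
     support. *)
  have [prop1|eq1] := EM (exists r, q r /\ ~ P1 r).
    exact: (Supp_sub_of_proper S1 S2 Sq).
  apply: Ass_minimal => // r /s2 qr.
  by apply: contrapT => nP1r; apply: eq1; exists r.
by split; apply: sub.
Qed.

End LinearlyEquivalentTopologies.

(** * Condition (ii) implies linear equivalence *)

Section OneDimensional.
Hypotheses (dimN : mod_dim_le N 1)
  (singleN : forall p, in_Supp N p -> loc_Ass_single N p).

Lemma Ass_unique_below q P1 P2 :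
  in_Supp N q ->
  Ass_quot (fun x : N => x = 0) P1 -> (forall a, P1 a -> q a) ->
  Ass_quot (fun x : N => x = 0) P2 -> (forall a, P2 a -> q a) ->
  forall a, P1 a -> P2 a.
Proof.
move=> Sq A1 s1 A2 s2 a; have [I [_ Iuniq]] := singleN Sq; have [qprime _] := Sq.
have [_ q1 _] := qprime.
have E1 := Iuniq _ (loc_Ass_of_Ass qprime A1 s1) a 1 q1.
have E2 := Iuniq _ (loc_Ass_of_Ass qprime A2 s2) a 1 q1.
by move=> P1a; apply/E2/E1.
Qed.

Lemma lin_equiv_of_dim_le1 b : lin_equiv_topologies N b.
Proof.
pose J n r := forall y : N, bpowN b n y -> r *: y = 0.
have JS m n r : (m <= n)%N -> J m r -> J n r.
  by move=> le_mn Jr y /(bpowN_le le_mn) /Jr.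
have [||k0 k0P] := HR (c := J).
- move=> n; split=> [y _|a c Ja Jc y By|r a Ja y By]; first by rewrite scale0r.
    by rewrite scalerDl Ja // Jc // addr0.
  by rewrite -scalerA Ja // scaler0.
- by move=> n r; apply: JS.
(* [k0] is where the annihilators J n of b^n N become stationary. It remains to show that the prime
   of every component of b^(n+k) N is minimal in Ass(N/bN). *)
exists k0.+1 => n t Q [primQ eqQ _ irrQ] x Sx.
apply: (bpowN_le (leq_addr k0.+1 n)); apply/eqQ => i lti; apply: (Sx i lti).
set q := prim_rad (Q i).
have primi := primQ i lti; have qprime : is_prime_ideal q by apply: prim_rad_prime.
have [sQi [x1 Qx1] _] := primi; have [Qi0 QiD QiZ] := sQi.
have Sq : in_Supp N q.
  apply/in_SuppE; split=> //; exists x1 => u ux; apply: contrapT => qu; apply: Qx1.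
  by apply: primary_cancel qu => //; rewrite ux.
have bq a : b a -> q a.
  move=> ba; exists (n + k0.+1)%N => y; apply: (eqQ _).1 lti; exact: bpowN_exp.
suff key p : Ass_quot (@bpowN R N b 1) p -> (forall r, p r -> q r) ->
    forall r, q r -> p r.
  have [P' [AP' P'q]] := Ass_quot_bpowN_below Sq bq.
  split=> //; split=> //; case: (AP') => _ [z zP']; exists z => r; rewrite -zP'.
  by split; [apply: key|apply: P'q].
move=> Ap pq s qs; apply: contrapT => nps.
have Sp := Ass_quot_Supp (bpowN_submod N b 1) Ap.
have [pprime [z zp]] := Ap.
have bp a : b a -> p a by move=> ba; apply/zp; exact: bpowN1_gen.
have [p0 [Ap0 p0p]] := Ass_below Sp.
have Sp0 := Ass_quot_Supp (submod0 N) Ap0.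
have pp0 r : p r -> p0 r.
  move=> pr; apply: contrapT => p0r.
  (* Otherwise p0 < p < q is a forbidden chain; the default of [nth] supplies q at index 2. *)
  apply: (dimN (c := fun i => nth q [:: p0; p] i)) => [[|[|[|]]] //|[|[|]] //= _].
    by split=> //; exists r.
  by split=> //; exists s.
have Ass_q P : Ass_quot (fun x : N => x = 0) P -> (forall a, P a -> q a) ->
    forall a, P a <-> p a.
  move=> AP Pq a; split=> [Pa|/pp0 p0a].
    by apply: (p0p); apply: (Ass_unique_below Sq AP Pq Ap0) Pa => r /p0p /pq.
  by apply: (Ass_unique_below Sq Ap0 _ AP Pq) p0a => r /p0p /pq.
have [_ q1 _] := qprime.
(* If no power of a killed w locally at q, an associated prime below q would avoid a; but that prime
   is p, which contains b. *)
have b_nil a w : b a -> exists m, saturation q (fun y : N => y = 0) (a ^+ m *: w).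
  move=> ba; apply: contrapT => nom.
  have [|||r [rprime rS]] := Ass_quot_avoiding
      (S := fun c => exists u m, ~ q u /\ c = u * a ^+ m) (z := w) (submod0 N).
  - by exists 1, 0%N; rewrite mulr1.
  - move=> _ _ [u [m [qu ->]]] [u' [m' [qu' ->]]]; exists (u * u'), (m + m')%N.
    by rewrite exprD mulrACA; split=> //; apply: prime_mulNN.
  - by move=> _ [u [m [qu ->]]] uw; apply: nom; exists m, u; rewrite scalerA.
  have Pq c : c *: (r *: w) = 0 -> q c.
    move=> cw; apply: contrapT => qc; apply: (rS c) => //.
    by exists c, 0%N; rewrite mulr1.
  apply: (rS a); first by exists 1, 1%N; rewrite mul1r.
  apply/(Ass_q (fun c => c *: (r *: w) = 0)) => //; last exact: bp.
  by split=> //; exists (r *: w).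
have [m mP] := colonpow_full (saturation_submod qprime (submod0 N)) b_nil.
have [u [qu uP]] := saturation0_uniform qprime.
(* Locally at q, b^m N vanishes, and one u outside q kills the kernel of localization; stationarity
   lowers m to [k0]. *)
have Ju : J k0 u.
  apply: (k0P (maxn m k0)); first exact: leq_maxr.
  apply: (JS m); first exact: leq_maxl.
  move=> y By; apply: uP.
  exact: bpowN_sub_colonpow (saturation_submod qprime (submod0 N)) mP By.
(* By irredundancy some y lies in all components but [Q i]. Then s^M y is in b^(n+k) N, so u s^M
   kills y; but y survives at q, and this forces u s^M into p. *)
have [y /not_implyP[Qy nQiy]] := (existsNP _).2 (irrQ i lti).
have [M sM] := qs.
have usy : u *: (s ^+ M *: y) = 0.
  apply: Ju; apply: (@bpowN_le _ _ _ _ (n + k0.+1)).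
    by rewrite addnS leqW // leq_addl.
  apply/eqQ => j ltj; have [->|/eqP neji] := eqVneq j i; first exact: sM.
  by case: (primQ j ltj) => [[_ _ QZ] _ _]; apply/QZ/Qy.
have [[v [qv vy]]|nov] := EM (exists v, ~ q v /\ v *: y = 0).
  by apply: nQiy; apply: (primary_cancel primi _ qv); rewrite vy.
have [|r [Ar rq]] := Ass_quot_below (z := y) qprime (submod0 N).
  by move=> v vy; apply: contrapT => qv; apply: nov; exists v.
have : p (u * s ^+ M).
  apply/(Ass_q _ Ar rq).
  by rewrite scalerA mulrC -scalerA -scalerA usy scaler0.
by apply: prime_mulNN => //; [move/pq|apply: prime_expN].
Qed.

End OneDimensional.

End FiniteModules.

Theorem theorem2p4 (R : comNzRingType) (N : lmodType R)
  (HR : noetherian R) (HN : fin_gen N) (Hnz : exists x : N, (x != 0)%R) :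
  (forall b : R -> Prop, is_ideal b -> N_proper N b -> lin_equiv_topologies N b)
  <->
  (mod_dim_le N 1 /\ forall p : R -> Prop, in_Supp N p -> loc_Ass_single N p).
Proof.
split=> [lin_equiv|[dimN singleN] b _ _].
  split; first exact: dim_le1_of_lin_equiv.
  by move=> p Sp; apply: loc_Ass_single_of_lin_equiv.
exact: lin_equiv_of_dim_le1.
Qed.
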